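(* Let $G$ be a Dyck graph on $\{1,\dots,n\}$ and let $u$ be a packed word of length $n$. The coefficient of $\mathbf{M}_u$ in $\omega\mathbf{X}_G$ is $$\sum_{\gamma}t^{\mathrm{asc}_G(\gamma,u)},$$ where the sum runs over the acyclic orientations $\gamma$ of $G$ without $u$-descent, that is, containing no arc $(i,j)$ (directed from $i$ to $j$) with $u_j<u_i$, and $\mathrm{asc}_G(\gamma,u)$ is the number of arcs $(i,j)$ of $\gamma$ such that $i<j$.
   Context: A Dyck graph is a simple graph on $\{1,\dots,n\}$ such that whenever $\{i,j\}$ with $i<j$ is an edge, all $\{i',j'\}$ with $i\le i'<j'\le j$ are edges. A word $u$ over the positive integers is packed if the set of its letters is $\{1,\dots,r\}$, $r=\max(u)$; it encodes the set composition $(u^{-1}(1),\dots,u^{-1}(r))$ of the set of positions. For packed words of the same length, $v\le u$ means that the set composition of $v$ is obtained from that of $u$ by merging adjacent blocks. $\mathbf{WQSym}$ is the algebra of quasi-symmetric functions in noncommuting variables, with basis $\mathbf{M}_u=\sum_{\mathrm{pack}(w)=u}w$ ($u$ packed; $\mathrm{pack}(w)$ replaces the letters of $w$ by $1,2,\dots$ in an order-preserving way). The noncommutative chromatic quasi-symmetric function is $\mathbf{X}_G=\sum_{c}t^{\mathrm{asc}_G(c)}\mathbf{M}_c$, the sum being over proper packed colorings $c$ of $G$ (packed words of length $n$ with $c_i\ne c_j$ for every edge $\{i,j\}$), where $\mathrm{asc}_G(c)$ is the number of edges $\{i,j\}$ with $i<j$ and $c_i<c_j$. The $\omega$-involution of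 $\mathbf{WQSym}$ is the linear map $\omega\mathbf{M}_u=(-1)^{n-r}\sum_{v\le u}\mathbf{M}_v$, where $n=|u|$ and $r=\max(u)$. *)

(* Defs.v *)
From HB Require Import structures.
From mathcomp Require Import all_boot all_order all_algebra.
From mathcomp Require Import boolp classical_sets functions cardinality fsbigop.

Set Implicit Arguments.
Unset Strict Implicit.
Unset Printing Implicit Defensive.

Import GRing.Theory.

Local Open Scope ring_scope.

Definition wmax (w : seq nat) : nat := \max_(a <- w) a.

Definition word := {w : seq nat | 0%N \notin w}.

Definition packed (u : seq nat) : bool :=
  perm_eq (undup u) (iota 1 (wmax u)).

Lemma packed_pos (u : seq nat) : packed u -> 0%N \notin u.
Proof. by move=> pu; rewrite -mem_undup (perm_mem pu) mem_iota. Qed.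

Definition pword := {u : seq nat | packed u}.

Definition word_of (u : pword) : word := exist _ (val u) (packed_pos (valP u)).

Definition pack (w : seq nat) : seq nat :=
  [seq (count (ltn^~ a) (undup w)).+1 | a <- w].

Lemma pack_id (u : pword) : pack (val u) = val u.
Proof.
case: u => u /= pu; rewrite /pack -[RHS]map_id; apply/eq_in_map => a au.
have [a0 amax]: (0 < a)%N /\ (a <= wmax u)%N.
  by move: au; rewrite -mem_undup (perm_mem pu) mem_iota add1n ltnS => /andP.
move/permP: pu => ->; have ->: wmax u = (a.-1 + (wmax u - a.-1))%N.
  by rewrite subnKC // (leq_trans _ amax) // leq_pred.
rewrite iotaD count_cat add1n prednK // -[RHS](prednK a0); congr _.+1.
have /eqP ->: count (ltn^~ a) (iota 1 a.-1) == a.-1.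
  rewrite -[X in _ == X](size_iota 1) -all_count; apply/allP => i.
  by rewrite mem_iota add1n prednK // => /andP[].
apply/eqP; rewrite -[X in _ == X]addn0 eqn_add2l -leqn0 leqNgt -has_count.
by apply/hasPn => i; rewrite mem_iota -leqNgt => /andP[].
Qed.

(* Packed words of length n have all their letters in {1, ..., n}, so the
   n-tuples over {0, ..., n} include all of them (see mem_packed_words). *)
Definition packed_words (n : nat) : seq pword :=
  pmap insub [seq map val (tval t) | t : n.-tuple 'I_n.+1].

Lemma mem_packed_words n (u : pword) :
  (u \in packed_words n) = (size (val u) == n).
Proof.
rewrite mem_pmap_sub; apply/mapP/eqP => [[t _ ->]|sz].
  by rewrite size_map size_tuple.
have lt_u a : a \in val u -> (a < n.+1)%N.
  move=> au; have pu := valP u; rewrite ltnS -sz.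
  have: (wmax (val u) <= size (val u))%N.
    by rewrite -[leqLHS](size_iota 1) -(perm_size pu) size_undup.
  apply: leq_trans; move: au.
  by rewrite -mem_undup (perm_mem pu) mem_iota add1n ltnS => /andP[].
have st : size [seq inord a : 'I_n.+1 | a <- val u] == n.
  by rewrite size_map sz.
exists (Tuple st); first by rewrite mem_enum.
rewrite /= -map_comp -[LHS]map_id; apply/eq_in_map => a /lt_u la /=.
by rewrite inordK.
Qed.

Lemma packed_words_uniq n : uniq (packed_words n).
Proof.
apply: pmap_sub_uniq; rewrite map_inj_uniq ?enum_uniq //.
by move=> s t /(inj_map val_inj) /val_inj.
Qed.

(* The letter in position i : 'I_n of a word c is nth 0 c i; positions are
   numbered from 0. *)
Definition set_composition (n : nat) (u : seq nat) : seq {set 'I_n} :=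
  [seq [set i : 'I_n | nth 0%N u i == k] | k <- iota 1 (wmax u)].

Definition merging (T : finType) (Q P : seq {set T}) : Prop :=
  exists2 bs : seq (seq {set T}), [::] \notin bs &
    P = flatten bs /\ Q = [seq \bigcup_(A <- b) A | b <- bs].

Definition word_le (v u : seq nat) : bool :=
  (size v == size u) &&
  `[< merging (set_composition (size u) v) (set_composition (size u) u) >].

(* Formal series in noncommuting variables: w |-> coefficient of w. *)
Definition nc_series (R : comNzRingType) : lmodType R := word -> R^o.

Definition Mser (R : comNzRingType) (u : pword) : nc_series R :=
  fun w => (pack (val w) == val u)%:R.

Definition in_wqsym (R : comNzRingType) : {pred nc_series R} :=
  fun f => `[< exists s : seq (R * pword),
                 f = \sum_(x <- s) x.1 *: Mser R x.2 >].

Arguments in_wqsym : clear implicits.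

Lemma in_wqsymP (R : comNzRingType) (f : nc_series R) :
  reflect (exists s : seq (R * pword), f = \sum_(x <- s) x.1 *: Mser R x.2)
          (f \in in_wqsym R).
Proof. exact: asboolP. Qed.

Lemma in_wqsym_submod (R : comNzRingType) : submod_closed (in_wqsym R).
Proof.
split; first by apply/in_wqsymP; exists [::]; rewrite big_nil.
move=> a f g /in_wqsymP[s ->] /in_wqsymP[s' ->]; apply/in_wqsymP.
exists ([seq (a * x.1, x.2) | x <- s] ++ s').
rewrite big_cat big_map scaler_sumr; congr (_ + _).
by apply: eq_bigr => x _; rewrite scalerA.
Qed.

HB.instance Definition _ (R : comNzRingType) :=
  GRing.isSubmodClosed.Build R (nc_series R) (in_wqsym R)
    (in_wqsym_submod R).

Record WQSym (R : comNzRingType) := MkWQSym {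
  wqsym_val : nc_series R;
  wqsym_valP : wqsym_val \in in_wqsym R
}.

HB.instance Definition _ (R : comNzRingType) :=
  [isSub for @wqsym_val R].
HB.instance Definition _ (R : comNzRingType) :=
  [Choice of WQSym R by <:].
HB.instance Definition _ (R : comNzRingType) :=
  [SubChoice_isSubLmodule of WQSym R by <:].

Lemma Mser_in (R : comNzRingType) (u : pword) : Mser R u \in in_wqsym R.
Proof. by apply/in_wqsymP; exists [:: (1, u)]; rewrite big_seq1 scale1r. Qed.

Definition M (R : comNzRingType) (u : pword) : WQSym R := MkWQSym (Mser_in R u).

(* The coefficient of M_u in f is the coefficient of the word u in the series
   f: see Mcoef_M and WQSym_expand. *)
Definition Mcoef (R : comNzRingType) (u : pword) (f : WQSym R) : R :=
  val f (word_of u).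

Lemma Mcoef_is_linear (R : comNzRingType) (u : pword) :
  scalar (@Mcoef R u).
Proof. by []. Qed.

HB.instance Definition _ (R : comNzRingType) (u : pword) :=
  GRing.isLinear.Build R (WQSym R) R _ (@Mcoef R u) (Mcoef_is_linear u).

Lemma Mcoef_M (R : comNzRingType) (u v : pword) :
  Mcoef u (M R v) = (u == v)%:R.
Proof. by rewrite /Mcoef /= /Mser /= pack_id. Qed.

Lemma WQSym_span (R : comNzRingType) (f : WQSym R) :
  exists s : seq (R * pword), f = \sum_(x <- s) x.1 *: M R x.2.
Proof.
have /in_wqsymP[s fE] := wqsym_valP f; exists s; apply: val_inj.
by rewrite raddf_sum [LHS]fE.
Qed.

Lemma Mcoef_supp (R : comNzRingType) (f : WQSym R) :
  exists2 s : seq pword, uniq s & forall u, u \notin s -> Mcoef u f = 0.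
Proof.
have [s ->] := WQSym_span f; exists (undup [seq x.2 | x <- s]).
  exact: undup_uniq.
move=> u; rewrite mem_undup => us; rewrite linear_sum big_seq big1 // => x xs.
rewrite linearZ /= Mcoef_M; case: eqP => [ux|]; last by rewrite mulr0.
by case/negP: us; rewrite ux map_f.
Qed.

Lemma sum_Mcoef (R : comNzRingType) (f : WQSym R) (F : pword -> WQSym R)
    (s : seq pword) : uniq s -> (forall u, u \notin s -> Mcoef u f = 0) ->
  \sum_(u \in [set: pword]) Mcoef u f *: F u =
  \sum_(u <- s) Mcoef u f *: F u.
Proof.
move=> us f0; rewrite [RHS]fsbig_seq //; symmetry.
apply: fsbig_widen => //.
by move=> u /= [_ /negP /f0 ->]; rewrite scale0r.
Qed.

Lemma WQSym_expand (R : comNzRingType) (f : WQSym R) :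
  f = \sum_(u \in [set: pword]) Mcoef u f *: M R u.
Proof.
have [s us f0] := Mcoef_supp f; rewrite (sum_Mcoef _ us f0).
have [r fE] := WQSym_span f.
have coefE u : Mcoef u f = \sum_(x <- r) x.1 * (u == x.2)%:R.
  by rewrite fE linear_sum; apply: eq_bigr => x _; rewrite linearZ /= Mcoef_M.
set q := undup (s ++ [seq x.2 | x <- r]).
have uq : uniq q by exact: undup_uniq.
rewrite -(sum_Mcoef _ us f0) (sum_Mcoef _ uq); last first.
  by move=> u; rewrite mem_undup mem_cat negb_or => /andP[/f0].
under eq_bigr do rewrite coefE scaler_suml.
rewrite exchange_big [LHS]fE /=; apply: eq_big_seq => x xr.
rewrite (bigD1_seq x.2) //=; last by rewrite mem_undup mem_cat map_f ?orbT.
rewrite eqxx mulr1 big1 ?addr0 // => u /negPf ->.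
by rewrite mulr0 scale0r.
Qed.

Definition omegaM (R : comNzRingType) (u : pword) : WQSym R :=
  (-1) ^+ (size (val u) - wmax (val u)) *:
  \sum_(v <- packed_words (size (val u)) | word_le (val v) (val u)) M R v.

Definition omega (R : comNzRingType) (f : WQSym R) : WQSym R :=
  \sum_(u \in [set: pword]) Mcoef u f *: omegaM R u.

Lemma omega_is_linear (R : comNzRingType) : linear (@omega R).
Proof.
move=> a f g; have [s us f0] := Mcoef_supp f; have [r ur g0] := Mcoef_supp g.
set q := undup (s ++ r); have uq : uniq q by exact: undup_uniq.
have fq u : u \notin q -> Mcoef u f = 0.
  by rewrite mem_undup mem_cat negb_or => /andP[/f0].
have gq u : u \notin q -> Mcoef u g = 0.
  by rewrite mem_undup mem_cat negb_or => /andP[_ /g0].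
rewrite /omega !(sum_Mcoef _ uq) //; last first.
  by move=> u nu; rewrite linearP /= fq ?gq // mulr0 addr0.
rewrite scaler_sumr -big_split; apply: eq_bigr => u _ /=.
by rewrite linearP /= scalerDl -scalerA.
Qed.

HB.instance Definition _ (R : comNzRingType) :=
  GRing.isLinear.Build R (WQSym R) (WQSym R) _ (@omega R) (@omega_is_linear R).

Lemma omega_M (R : comNzRingType) (u : pword) : omega (M R u) = omegaM R u.
Proof.
rewrite /omega (@sum_Mcoef R _ _ [:: u]) //.
  by rewrite big_seq1 Mcoef_M eqxx scale1r.
by move=> v; rewrite inE Mcoef_M => /negPf ->.
Qed.

Definition simple_graph (n : nat) (e : rel 'I_n) : Prop :=
  symmetric e /\ irreflexive e.

Definition dyck_graph (n : nat) (e : rel 'I_n) : Prop :=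
  simple_graph e /\
  forall i j i' j' : 'I_n, (i < j)%N -> e i j ->
    (i <= i')%N -> (i' < j')%N -> (j' <= j)%N -> e i' j'.

Definition proper_coloring (n : nat) (e : rel 'I_n) (c : seq nat) : bool :=
  [forall i : 'I_n, forall j : 'I_n, e i j ==> (nth 0%N c i != nth 0%N c j)].

Definition asc_coloring (n : nat) (e : rel 'I_n) (c : seq nat) : nat :=
  #|[set p : 'I_n * 'I_n |
      [&& e p.1 p.2, (p.1 < p.2)%N & (nth 0%N c p.1 < nth 0%N c p.2)%N]]|.

(* The indeterminate t is the variable of {poly K}. *)
Definition chromatic (K : comNzRingType) (n : nat) (e : rel 'I_n) :
    WQSym {poly K} :=
  \sum_(c <- packed_words n | proper_coloring e (val c))
    'X^(asc_coloring e (val c)) *: M {poly K} c.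

(* A set of arcs, (i, j) being directed from i to j, with exactly one arc for
   each edge. *)
Definition orientation (n : nat) (e : rel 'I_n) (g : {set 'I_n * 'I_n}) : bool :=
  [forall p in g, e p.1 p.2] &&
  [forall i, forall j, e i j ==> ((i, j) \in g) (+) ((j, i) \in g)].

Definition acyclic (n : nat) (g : {set 'I_n * 'I_n}) : Prop :=
  forall p : seq 'I_n, cycle [rel i j | (i, j) \in g] p -> p = [::].

Definition no_descent (n : nat) (g : {set 'I_n * 'I_n}) (u : seq nat) : bool :=
  [forall p in g, ~~ (nth 0%N u p.2 < nth 0%N u p.1)%N].

Definition asc_orientation (n : nat) (g : {set 'I_n * 'I_n}) : nat :=
  #|[set p in g | (p.1 < p.2)%N]|.

(* Main.v *)
Require Import Defs.
From HB Require Import structures.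
From mathcomp Require Import all_boot all_order all_algebra.
From mathcomp Require Import boolp classical_sets functions cardinality fsbigop.
From mathcomp Require Import zify.

Set Implicit Arguments.
Unset Strict Implicit.
Unset Printing Implicit Defensive.

Import GRing.Theory.

Local Open Scope ring_scope.

(* M_u occurs in omega(M_c) exactly when c_i < c_j for all i, j with u_i < u_j,
   so the coefficient is a signed sum over the proper colorings c with this
   property. Group it by the set g of arcs along which c increases: this is an
   acyclic orientation without u-descent. The colorings attached to g are the
   strictly increasing packed colorings of the acyclic relation D consisting of
   g and of the pairs (i, j) with u_i < u_j, and their signs (-1)^(n - max c) add
   up to 1 for any acyclic relation D. Indeed, if x is minimal for D, merging
   the block {x} into the block before it and, when x is not alone in its
   block, splitting it off right after that block are mutually inverse and
   change the sign; only the colorings whose first block is {x} survive, and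
   one goes on with a minimal element of the rest. *)

(** * Packed words and cancellation of signs *)

Lemma leq_wmax (s : seq nat) (a : nat) : a \in s -> (a <= wmax s)%N.
Proof. by move=> sa; apply: (leq_bigmax_seq (F := id)). Qed.

Lemma wmax_mem (s : seq nat) : (0 < wmax s)%N -> wmax s \in s.
Proof.
rewrite /wmax; elim: s => [|a s IH]; first by rewrite big_nil.
rewrite big_cons inE; case: (leqP a (\max_(b <- s) b)%N) => [_ /IH -> //|_ _].
  by rewrite orbT.
by rewrite eqxx.
Qed.

Lemma mem_packed (s : seq nat) (a : nat) :
  packed s -> (a \in s) = (0 < a <= wmax s)%N.
Proof.
by move=> ps; rewrite -mem_undup (perm_mem ps) mem_iota add1n ltnS.
Qed.

(** Closure under smaller positive letters can be checked letter by letter on a modified word,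
    without knowing its maximum. *)
Lemma packedP (s : seq nat) :
  packed s <->
  0%N \notin s /\ forall k m, m \in s -> (0 < k <= m)%N -> k \in s.
Proof.
split=> [ps | [s0 down]].
  split=> [|k m]; first by rewrite mem_packed.
  by rewrite !mem_packed // => /andP[_ ms] /andP[-> /leq_trans]; apply.
apply: uniq_perm (undup_uniq s) (iota_uniq _ _) _ => k.
rewrite mem_undup mem_iota add1n ltnS; apply/idP/idP => [sk|k_bnd].
  by rewrite leq_wmax // andbT lt0n; apply: contraNneq s0 => <-.
case/andP: (k_bnd) => k0 kmax.
by apply: down k_bnd; apply: wmax_mem; apply: leq_trans kmax.
Qed.

Lemma wmax_packed (s : seq nat) : packed s -> wmax s = size (undup s).
Proof. by move/perm_size ->; rewrite size_iota. Qed.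

Lemma wmax_packed_le (s : seq nat) : packed s -> (wmax s <= size s)%N.
Proof. by move/wmax_packed ->; rewrite size_undup. Qed.

(** [h] permutes the selected terms, so the sum is its own opposite. It vanishes because the values
    are integers, which have no 2-torsion. *)
Lemma sum_sign_reversing (I : eqType) (r : seq I) (Q : pred I) (F : I -> int)
    (h : I -> I) :
  uniq r ->
  (forall c, c \in r -> Q c ->
     [/\ h c \in r, Q (h c), h (h c) = c & F (h c) = - F c]) ->
  \sum_(c <- r | Q c) F c = 0.
Proof.
move=> ur hP; rewrite -big_filter; set L := [seq c <- r | Q c].
have LP c : c \in L -> [/\ h c \in L, h (h c) = c & F (h c) = - F c].
  rewrite mem_filter => /andP[Qc rc]; have [? ? ? ?] := hP c rc Qc.
  by split=> //; rewrite mem_filter; apply/andP.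
have pL : perm_eq [seq h c | c <- L] L.
  apply: uniq_perm; rewrite ?filter_uniq //.
    rewrite map_inj_in_uniq ?filter_uniq // => a b /LP[_ aK _] /LP[_ bK _] ab.
    by rewrite -aK ab bK.
  move=> c; apply/mapP/idP => [[d /LP[? _ _] -> //]|Lc].
  by have [hL hK _] := LP c Lc; exists (h c).
have : \sum_(c <- L) F c = - \sum_(c <- L) F c.
  rewrite -[in LHS](perm_big _ pL) big_map -sumrN /=.
  by apply: eq_big_seq => c /LP[].
by move: (\sum_(c <- L) F c) => S; lia.
Qed.

(** * Words as functions of the position; splitting and merging blocks *)

Section Words.

Variable n : nat.
Implicit Types (f : 'I_n -> nat) (x : 'I_n).

Definition word_fun f : seq nat := [seq f i | i <- enum 'I_n].

Lemma size_word_fun f : size (word_fun f) = n.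
Proof. by rewrite size_map size_enum_ord. Qed.

Lemma nth_word_fun f (i : 'I_n) : nth 0%N (word_fun f) i = f i.
Proof. by rewrite (nth_map i) ?size_enum_ord // nth_ord_enum. Qed.

Lemma mem_word_fun f (a : nat) : reflect (exists i, f i = a) (a \in word_fun f).
Proof.
apply: (iffP mapP) => [[i _ ->]|[i <-]]; first by exists i.
by exists i; rewrite ?mem_enum.
Qed.

Lemma word_funK (s : seq nat) :
  size s = n -> word_fun (fun i => nth 0%N s i) = s.
Proof.
move=> sn; apply: (@eq_from_nth _ 0%N); rewrite size_word_fun // => i ilt.
exact: (nth_word_fun _ (Ordinal ilt)).
Qed.

Lemma packed_word_fun f :
  (forall i, 0 < f i)%N ->
  (forall i k, (0 < k <= f i)%N -> exists j, f j = k) ->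
  packed (word_fun f).
Proof.
move=> f0 fdown; apply/packedP; split.
  by apply/negP => /mem_word_fun[i fi]; have := f0 i; rewrite fi.
by move=> k m /mem_word_fun[i <-] /fdown ?; apply/mem_word_fun.
Qed.

Lemma nth_packed (s : seq nat) : packed s -> size s = n ->
  (forall i : 'I_n, 0 < nth 0%N s i <= wmax s)%N /\
  (forall k, (0 < k <= wmax s)%N -> exists i : 'I_n, nth 0%N s i = k).
Proof.
move=> ps sn; split=> [i|k].
  by rewrite -mem_packed // mem_nth // sn.
rewrite -mem_packed // -[in X in X -> _](word_funK sn) => /mem_word_fun[i ik].
by exists i.
Qed.

Definition alone x f : bool := [forall y, (f y == f x) ==> (y == x)].

Lemma aloneP x f : reflect (forall y, f y = f x -> y = x) (alone x f).
Proof.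
apply: (iffP forallP) => H y; first by move/eqP=> yx; apply/eqP/(implyP (H y)).
by apply/implyP => /eqP /H ->.
Qed.

(* Merge the block {x} into the block before it, or split x off from its block
   and insert it as a block of its own right after it. *)
Definition toggle x f (i : 'I_n) : nat :=
  if alone x f then (f i - (f x <= f i))%N
  else (f i + ((f x < f i) || (i == x)))%N.

Lemma alone_toggle_split x f : ~~ alone x f -> alone x (toggle x f).
Proof.
move=> na; apply/aloneP => y; rewrite /toggle (negPf na) eqxx orbT.
by case: eqP => //; lia.
Qed.

Lemma alone_toggle_merge x f :
  (forall i k, (0 < k <= f i)%N -> exists j, f j = k) -> (1 < f x)%N ->
  alone x f -> ~~ alone x (toggle x f).
Proof.
move=> fdown fx a; have [|z fz] := fdown x (f x).-1; first by lia.
apply/aloneP => /(_ z); rewrite /toggle a leqnn fz.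
have -> : (f x <= (f x).-1)%N = false by lia.
by move=> /(_ ltac:(lia)) zx; move: fz; rewrite zx; lia.
Qed.

(** A merge shifts the letters from [f x] on down by one; a split shifts up those above [f x] and
    that of [x]. The bound [1 < f x] provides the block into which a lone [x] merges. *)
Lemma toggleK x f :
  (forall i k, (0 < k <= f i)%N -> exists j, f j = k) ->
  (alone x f -> 1 < f x)%N ->
  toggle x (toggle x f) =1 f.
Proof.
move=> fdown fx i; case: (boolP (alone x f)) => a.
  rewrite {1}/toggle (negPf (alone_toggle_merge fdown (fx a) a)).
  rewrite /toggle a leqnn.
  have := fx a; have /aloneP/(_ i) := a.
  case: eqP => [->|]; first by lia.
  by move=> ne H; have : f i <> f x by [move/H]; lia.
rewrite {1}/toggle (alone_toggle_split a) /toggle (negPf a) eqxx orbT.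
by case: eqP => [->|]; lia.
Qed.

Lemma toggle_packed x f :
  (forall i, 0 < f i)%N ->
  (forall i k, (0 < k <= f i)%N -> exists j, f j = k) ->
  (alone x f -> 1 < f x)%N ->
  packed (word_fun (toggle x f)).
Proof.
move=> f0 fdown fx; apply: packed_word_fun => [i|i k].
  rewrite /toggle; case: ifP => [/fx|]; have := f0 i; lia.
rewrite /toggle; case: (boolP (alone x f)) => [/fx|] a /= k_bnd.
  (* After a merge, a letter [k] comes from [k] if it is below [f x], and from [k.+1] otherwise. *)
  have [kx|kx] := ltnP k (f x).
    by have [|j fj] := fdown i k; [|exists j]; lia.
  by have [|j fj] := fdown i k.+1; [|exists j]; lia.
(* A second element [z] of the block keeps the letter [f x] in use once [x] has left. *)
have [z zx fz] : exists2 z, z <> x & f z = f x.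
  by case/forallPn: a => z; rewrite negb_imply => /andP[/eqP ? /eqP]; exists z.
have [kx|kx] := leqP k (f x).
  have [j fj] : exists j, f j = k.
    by have [|j fj] := fdown x k; [lia|exists j].
  have [jx|jx] := eqVneq j x.
    by exists z; case: eqP => // _; rewrite fz -fj jx ltnn addn0.
  by exists j; rewrite (negPf jx); lia.
have [->|kx'] := eqVneq k (f x).+1; first by exists x; rewrite eqxx orbT addn1.
have [|j fj] := fdown i k.-1; first by lia.
by exists j; lia.
Qed.

Lemma wmax_toggle_split x f :
  ~~ alone x f -> wmax (word_fun (toggle x f)) = (wmax (word_fun f)).+1.
Proof.
move=> na; have le_f i : (f i <= wmax (word_fun f))%N.
  by apply: leq_wmax; apply/mem_word_fun; exists i.
apply/eqP; rewrite eqn_leq; apply/andP; split.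
  apply/bigmax_leqP_seq => a /mem_word_fun[i <-] _.
  by rewrite /toggle (negPf na); have := le_f i; lia.
have [i fi] : exists i, f i = wmax (word_fun f).
  case: (posnP (wmax (word_fun f))) => [f0|/wmax_mem/mem_word_fun //].
  by exists x; have := le_f x; lia.
(* A maximal letter above [f x] moves up by one; otherwise [x] lies in the last block and becomes
   the new last block. *)
have [fxi|fxi] := ltnP (f x) (f i).
  rewrite -fi; apply: leq_wmax; apply/mem_word_fun; exists i.
  by rewrite /toggle (negPf na) fxi addn1.
apply: (@leq_trans (toggle x f x)).
  by rewrite /toggle (negPf na) eqxx orbT; lia.
by apply: leq_wmax; apply/mem_word_fun; exists x.
Qed.

End Words.

(** * Merging adjacent blocks, expressed by inequalities between letters *)

Lemma find_bigcup_flatten (T : finType) (bs : seq (seq {set T})) (i j : T) :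
  let pos k (s : seq {set T}) := find (fun A : {set T} => k \in A) s in
  let Q := [seq \bigcup_(A <- b) A | b <- bs] in
  (pos i Q < pos j Q)%N -> (pos i (flatten bs) < pos j (flatten bs))%N.
Proof.
move=> pos /=; elim: bs => //= b bs IH.
have inE k : (k \in \bigcup_(A <- b) A) = has (fun A : {set T} => k \in A) b.
  by elim: b => [|A b IHb]; rewrite ?big_nil ?inE // big_cons inE IHb.
(* The first block containing an element lies in the first group whose union contains it, and the
   groups keep their order in the concatenation. *)
rewrite /pos !find_cat /= !inE; case: ifP => [hi|_]; case: ifP => //= _ lt.
  by move: hi; rewrite has_find; lia.
by rewrite ltn_add2l; apply: IH.
Qed.

(** Sortedness makes the entries of each label consecutive, so listing the label classes in
    increasing order does not reorder [s]. *)
Lemma flatten_filter_label (T : eqType) (lab : T -> nat) (s : seq T)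
    (p m : nat) :
  pairwise (fun x y => (lab x <= lab y)%N) s ->
  flatten [seq [seq x <- s | lab x == a] | a <- iota p m] =
  [seq x <- s | (p <= lab x < p + m)%N].
Proof.
move=> ps; elim: m p => [|m IH] p /=.
  by rewrite (eq_filter (a2 := pred0)) ?filter_pred0 // => x /=; lia.
rewrite IH; elim: s ps {IH} => //= x s IH /andP[/allP xs /IH {}IH].
have -> : (p <= lab x < p + m.+1)%N =
    (lab x == p) || (p.+1 <= lab x < p.+1 + m)%N.
  lia.
case: eqP => [xp|xp] /=; first by rewrite -IH xp ltnn.
case: ifP => [px|_] //; rewrite -IH.
(* After an entry with label above [p], no label equals [p]. *)
rewrite (eq_in_filter (a2 := pred0)) ?filter_pred0 // => y /xs /=; lia.
Qed.

Section Refine.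

Variable n : nat.

(** Blocks are numbered from 0 and letters from 1, hence the predecessor. *)
Lemma find_set_composition (s : seq nat) (i : 'I_n) :
  packed s -> size s = n ->
  find (fun A : {set 'I_n} => i \in A) (set_composition n s) = (nth 0%N s i).-1.
Proof.
move=> ps sn; have [/(_ i) bnd _] := nth_packed ps sn.
rewrite /set_composition find_map.
rewrite (eq_find (a2 := pred1 (nth 0%N s i))); last first.
  by move=> k /=; rewrite inE eq_sym.
rewrite -/(index _ _).
rewrite -[X in index X _](_ : nth 0%N (iota 1 (wmax s)) (nth 0%N s i).-1 = _).
  by rewrite index_uniq ?iota_uniq // size_iota; lia.
by rewrite nth_iota; lia.
Qed.

Definition refines (c u : seq nat) : bool :=
  [forall i : 'I_n, forall j : 'I_n,
     (nth 0%N u i < nth 0%N u j)%N ==> (nth 0%N c i < nth 0%N c j)%N].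

Lemma refinesP (c u : seq nat) :
  reflect (forall i j : 'I_n, (nth 0%N u i < nth 0%N u j)%N ->
             (nth 0%N c i < nth 0%N c j)%N) (refines c u).
Proof.
apply: (iffP forallP) => [H i j|H i]; first by apply/implyP/(forallP (H i)).
by apply/forallP => j; apply/implyP/H.
Qed.

(** In one direction, compare the indices of the blocks containing [i] and [j]. In the other,
    refinement makes the letter of [u] a weakly increasing function of the letter of [c], and its
    level sets are the groups to merge. *)
Lemma word_le_refines (c u : seq nat) :
  packed c -> size c = n -> packed u -> size u = n ->
  word_le u c = refines c u.
Proof.
move=> pc cn pu un; rewrite /word_le cn un eqxx /=.
have [cbnd cex] := nth_packed pc cn; have [ubnd uex] := nth_packed pu un.
apply/asboolP/refinesP => [[bs _ [cE uE]] i j ltu|ref].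
  have := @find_bigcup_flatten _ bs i j; rewrite -cE -uE /=.
  by rewrite !find_set_composition //; have := cbnd i; have := ubnd i; lia.
have same (i j : 'I_n) : nth 0%N c i = nth 0%N c j -> nth 0%N u i = nth 0%N u j.
  by move=> ij; have := ref i j; have := ref j i; lia.
(* The letter of [u] on block [k] of [c], read at the first occurrence of [k]; by [same] any other
   occurrence gives the same value. *)
pose lab (k : nat) := nth 0%N u (index k c).
have labE (i : 'I_n) : lab (nth 0%N c i) = nth 0%N u i.
  have ci : nth 0%N c i \in c by rewrite mem_nth ?cn.
  have ilt : (index (nth 0%N c i) c < n)%N by move: ci; rewrite -index_mem cn.
  by apply: (same (Ordinal ilt)); rewrite /= nth_index.
pose B (k : nat) := [set i : 'I_n | nth 0%N c i == k].
pose ks (a : nat) := [seq k <- iota 1 (wmax c) | lab k == a].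
exists [seq [seq B k | k <- ks a] | a <- iota 1 (wmax u)].
  apply/mapP => -[a]; rewrite mem_iota add1n ltnS => /uex[i <-].
  have : nth 0%N c i \in ks (nth 0%N u i); last by case: (ks _).
  by rewrite /ks mem_filter labE eqxx mem_iota add1n ltnS cbnd.
split.
  rewrite /set_composition -/B (map_comp (map B) ks) -map_flatten.
  rewrite flatten_filter_label; last first.
    apply: (@sub_in_pairwise _ (fun k => 0 < k <= wmax c)%N ltn); first last.
    - by rewrite -sorted_pairwise ?iota_ltn_sorted //; apply: ltn_trans.
    - by apply/allP => k; rewrite mem_iota add1n ltnS.
    move=> k m /cex[i <-] /cex[j <-] ij; rewrite !labE leqNgt.
    by apply/negP => /ref; lia.
  congr map; symmetry; apply/all_filterP/allP => k.
  by rewrite mem_iota add1n ltnS => /cex[i <-]; rewrite labE.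
rewrite -map_comp /set_composition; apply: eq_map => a /=; apply/setP => i.
rewrite inE big_map.
have -> : (i \in \bigcup_(k <- ks a) B k) = (nth 0%N c i \in ks a).
  elim: (ks a) => [|k s IH]; first by rewrite big_nil inE.
  by rewrite big_cons !inE IH.
by rewrite /ks mem_filter labE mem_iota add1n ltnS cbnd andbT.
Qed.

End Refine.

(** * The signed count of colorings strictly increasing along [D] *)

Section SignSum.

Variables (n : nat) (D : rel 'I_n).
(** Acyclicity of [D], in the form that the induction consumes. *)
Hypothesis D_wf : forall (S : {set 'I_n}) (z : 'I_n), z \in S ->
  exists2 x, x \in S & forall y, y \in S -> ~~ D y x.

Definition strict (c : seq nat) : bool :=
  [forall i : 'I_n, forall j : 'I_n, D i j ==> (nth 0%N c i < nth 0%N c j)%N].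

Lemma strictP (c : seq nat) :
  reflect (forall i j : 'I_n, D i j -> (nth 0%N c i < nth 0%N c j)%N)
    (strict c).
Proof.
apply: (iffP forallP) => [H i j|H i]; first by apply/implyP/(forallP (H i)).
by apply/forallP => j; apply/implyP/H.
Qed.

(* The first blocks of c are the singletons of the elements of s, in order. *)
Definition settled (s : seq 'I_n) (c : seq nat) : bool :=
  [forall i : 'I_n, if i \in s then nth 0%N c i == (index i s).+1
                    else (size s < nth 0%N c i)%N].

Lemma settledP (s : seq 'I_n) (c : seq nat) :
  reflect (forall i : 'I_n, if i \in s then nth 0%N c i = (index i s).+1
                            else (size s < nth 0%N c i)%N : Prop)
    (settled s c).
Proof.
apply: (iffP forallP) => H i; have := H i; case: ifP => // _.
  by move/eqP.
by move=> ->.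
Qed.

Lemma settled_rcons (s : seq 'I_n) (x : 'I_n) (c : seq nat) : x \notin s ->
  settled (rcons s x) c =
  [&& settled s c, nth 0%N c x == (size s).+1 & alone x (fun i => nth 0%N c i)].
Proof.
move=> xs; apply/settledP/and3P => [H|[/settledP H /eqP cx /aloneP al] i].
  have cx : nth 0%N c x = (size s).+1.
    have := H x; rewrite mem_rcons inE eqxx -cats1 index_cat (negPf xs) /= eqxx.
    by rewrite addn0.
  split; [| exact/eqP |].
    apply/settledP => i; have := H i; rewrite mem_rcons inE size_rcons.
    have [->|ix] := eqVneq i x; first by rewrite (negPf xs) cx.
    by rewrite -cats1 index_cat /=; case: (i \in s) => //; lia.
  apply/aloneP => i; have := H i; rewrite cx mem_rcons inE size_rcons.
  have [//|ix /=] := eqVneq i x; case: ifP => [si|_]; last by lia.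
  rewrite -cats1 index_cat si => -> [E].
  by move: si; rewrite -index_mem E ltnn.
have := H i; rewrite mem_rcons inE size_rcons.
have [->|ix /=] := eqVneq i x.
  by rewrite cx -cats1 index_cat (negPf xs) /= eqxx addn0.
rewrite -cats1 index_cat; case: ifP => // _ ci.
by have : nth 0%N c i <> nth 0%N c x by [move/al/eqP; rewrite (negPf ix)]; lia.
Qed.

(** The default [c] of [insubd] is returned only if the toggled word is not packed, which
    [toggle_packed] excludes wherever the involution is applied. *)
Definition toggle_word (x : 'I_n) (c : pword) : pword :=
  insubd c (word_fun (toggle x (fun i => nth 0%N (val c) i))).

(** [toggle_word x] preserves the three conditions and changes the number of blocks by one. *)
Lemma sum_unsettled (s : seq 'I_n) (x : 'I_n) :
  (forall y, D y x -> y \in s) -> x \notin s ->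
  \sum_(c <- packed_words n |
      strict (val c) && settled s (val c) && ~~ settled (rcons s x) (val c))
    (-1) ^+ (n - wmax (val c)) = 0 :> int.
Proof.
move=> Dx xs; apply: (@sum_sign_reversing _ _ _ _ (toggle_word x)).
  exact: packed_words_uniq.
move=> c; rewrite mem_packed_words => /eqP cn.
rewrite settled_rcons // => /andP[/andP[/strictP sc sett]].
rewrite sett andTb negb_and => nal; have /settledP cset := sett.
pose f (i : 'I_n) := nth 0%N (val c) i.
have [cbnd cex] := nth_packed (valP c) cn.
have f0 i : (0 < f i)%N by have := cbnd i; rewrite /f; lia.
have fdown i k : (0 < k <= f i)%N -> exists j, f j = k.
  by move=> k_bnd; apply: cex; have := cbnd i; rewrite /f in k_bnd *; lia.
have fx_s : (size s < f x)%N by have := cset x; rewrite (negPf xs).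
(* A lone [x] with letter [(size s).+1] would make [c] settled along [rcons s x]. So a merge still
   leaves [x] after the blocks of [s]. *)
have fx : alone x f -> ((size s).+1 < f x)%N.
  by move=> al; move: nal; rewrite -/(f x) al orbF; lia.
have fx1 : alone x f -> (1 < f x)%N by move/fx; lia.
have fs i : i \in s -> (f i <= size s)%N.
  by move=> si; have := cset i; rewrite si -/(f i) => ->; rewrite index_mem.
have tc : val (toggle_word x c) = word_fun (toggle x f).
  by rewrite val_insubd toggle_packed.
have tnth (i : 'I_n) : nth 0%N (val (toggle_word x c)) i = toggle x f i.
  by rewrite tc nth_word_fun.
have tfE : (fun i : 'I_n => nth 0%N (val (toggle_word x c)) i) = toggle x f.
  exact/funext.
have tfK : word_fun (toggle x (toggle x f)) = val c.
  by rewrite -[RHS](word_funK cn); apply: eq_map => i; exact: toggleK.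
have wmax_step : (wmax (val (toggle_word x c)) = (wmax (val c)).+1) \/
                 (wmax (val c) = (wmax (val (toggle_word x c))).+1).
  rewrite tc; case: (boolP (alone x f)) => al; [right | left].
    by rewrite -tfK wmax_toggle_split // alone_toggle_merge // fx1.
  by rewrite wmax_toggle_split // (word_funK cn).
have sc_f i j : D i j -> (f i < f j)%N by exact: sc.
split.
- by rewrite mem_packed_words tc size_word_fun.
- rewrite settled_rcons // tfE -andbA; apply/and3P; split.
  + apply/strictP => i j Dij; rewrite !tnth; have := sc_f i j Dij.
    rewrite /toggle; case: ifP => [al|nal']; last first.
      by have [->|_] := eqVneq i x; have [->|_] := eqVneq j x; lia.
    (* A merge only creates ties between [x] and the block before it; an element below [x] for [D]
       is in [s], hence in a still earlier block. *)
    have [jx|jx] := eqVneq j x.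
      by move: Dij; rewrite jx => /Dx /fs; have := fx al; lia.
    have : f j <> f x by move/(aloneP _ _ al)/eqP; rewrite (negPf jx).
    lia.
  + apply/settledP => i; rewrite tnth; have := cset i; rewrite -/(f i) /toggle.
    case: ifP => si; last first.
      by case: ifP => [/fx|]; lia.
    have := fs i si; case: ifP => [/fx|_]; first by lia.
    by have -> : (i == x) = false; [apply: contraNF xs => /eqP <-|lia].
  (* A merged [x] is no longer alone; a split [x] gets the letter [(f x).+1], beyond
     [(size s).+1]. *)
  + rewrite !negb_and; case: (boolP (alone x f)) => al.
      by rewrite (alone_toggle_merge fdown (fx1 al) al) !orbT.
    by rewrite tnth /toggle (negPf al) eqxx orbT; apply/or3P/Or32; lia.
- by apply: val_inj; rewrite val_insubd tfE tfK (valP c).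
(* The exponents are truncated differences; these bounds make them differ by exactly one. *)
have := wmax_packed_le (valP c); have := wmax_packed_le (valP (toggle_word x c)).
have -> : size (val (toggle_word x c)) = n by rewrite tc size_word_fun.
rewrite cn; case: wmax_step => -> lt lt'.
  by rewrite -[in RHS](subnSK lt) exprS mulN1r opprK.
by rewrite -[in LHS](subnSK lt') exprS mulN1r.
Qed.

Lemma mem_full (s : seq 'I_n) : uniq s -> (n <= size s)%N -> s =i 'I_n.
Proof.
move=> us ns; have sub : {subset s <= enum 'I_n} by move=> i; rewrite mem_enum.
have [|_ sE] := uniq_min_size us sub; first by rewrite size_enum_ord.
by move=> i; rewrite sE mem_enum.
Qed.

(** Here [s] is a linear extension of [D]; the only coloring left numbers the positions along [s],
    and its [n] blocks give the sign [+1]. *)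
Lemma sum_fully_settled (s : seq 'I_n) :
  uniq s -> (n <= size s)%N ->
  (forall x y, D y x -> (index y s < index x s)%N) ->
  \sum_(c <- packed_words n | strict (val c) && settled s (val c))
    (-1) ^+ (n - wmax (val c)) = 1 :> int.
Proof.
move=> us ns Ds; have s_all := mem_full us ns.
pose f (i : 'I_n) := (index i s).+1.
have pf : packed (word_fun f).
  apply: packed_word_fun => // i k k_bnd.
  have i_s : (index i s < size s)%N by rewrite index_mem s_all.
  case/andP: k_bnd => k0 k_le; exists (nth i s k.-1).
  by rewrite /f index_uniq ?prednK // (leq_trans k_le).
have uf : uniq (word_fun f).
  rewrite map_inj_uniq ?enum_uniq // => i j [ij].
  by rewrite -(nth_index i (_ : i \in s)) ?ij ?nth_index ?s_all.
pose c0 : pword := exist _ (word_fun f) pf.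
rewrite big_mkcond (bigD1_seq c0) ?packed_words_uniq ?mem_packed_words //=;
  last by rewrite size_word_fun.
rewrite ifT; last first.
  apply/andP; split.
    by apply/strictP => i j Dij; rewrite !nth_word_fun ltnS Ds.
  by apply/settledP => i; rewrite s_all nth_word_fun.
rewrite wmax_packed // undup_id // size_word_fun subnn big1_seq ?addr0 //.
move=> c /andP[cc0]; rewrite mem_packed_words => /eqP cn.
case: ifP => // /andP[_ /settledP H]; case/eqP: cc0; apply: val_inj.
rewrite -[LHS](word_funK cn); apply: eq_map => i.
by have := H i; rewrite s_all.
Qed.

(** Induction on the number of positions outside [s]. Since [index y s] is [size s] when [y] is not
    in [s], the last hypothesis also says that [s] is closed downwards for [D]. *)
Lemma sum_settled (s : seq 'I_n) :
  uniq s ->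
  (forall x y, D y x -> x \in s -> (index y s < index x s)%N) ->
  \sum_(c <- packed_words n | strict (val c) && settled s (val c))
    (-1) ^+ (n - wmax (val c)) = 1 :> int.
Proof.
have [m] := ubnP (n - size s); elim: m s => // m IH s lt_m us Ds.
have [ns|sn] := leqP n (size s).
  by apply: sum_fully_settled => // x y Dyx; apply: Ds; rewrite ?mem_full.
have [z zs] : exists z, z \in [set i | i \notin s].
  apply/existsP; apply: contraTT sn => /existsPn all_s.
  rewrite -leqNgt -[leqLHS]card_ord; apply: leq_trans (card_size s).
  apply/subset_leq_card/fintype.subsetP => i _.
  by have := all_s i; rewrite inE negbK.
have [x] := D_wf zs; rewrite inE => xs xmin.
have Dx y : D y x -> y \in s.
  by apply: contraTT => ys; apply: xmin; rewrite inE.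
rewrite (bigID (fun c : pword => settled (rcons s x) (val c))) /=.
rewrite sum_unsettled // addr0.
rewrite (eq_bigl (fun c => strict (val c) && settled (rcons s x) (val c))).
  apply: IH; rewrite ?size_rcons ?rcons_uniq ?xs //; first by lia.
  move=> a b Dba; rewrite mem_rcons inE -cats1 !index_cat.
  move: Dba; have [->|_] := eqVneq a x => Dba.
    by move=> _; rewrite (Dx _ Dba) (negPf xs) /= eqxx addn0 index_mem Dx.
  move=> /= a_s; have lt := Ds _ _ Dba a_s; rewrite a_s.
  by rewrite -index_mem (ltn_trans lt) // index_mem.
move=> c; rewrite settled_rcons // -andbA andbA.
by case: (strict _); case: (settled s _).
Qed.

Lemma sum_strict :
  \sum_(c <- packed_words n | strict (val c))
    (-1) ^+ (n - wmax (val c)) = 1 :> int.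
Proof.
rewrite -[RHS](@sum_settled [::]) // big_seq_cond [RHS]big_seq_cond.
apply: eq_bigl => c; rewrite mem_packed_words; case: eqP => //= cn.
have [cbnd _] := nth_packed (valP c) cn.
(* For the empty list, being settled only says that letters are positive. *)
suff -> : settled [::] (val c) by rewrite andbT.
by apply/settledP => i; have /andP[] := cbnd i.
Qed.

End SignSum.

(** * Acyclic orientations and ascents of colorings *)

Lemma acyclic_min (n : nat) (g : {set 'I_n * 'I_n}) (S : {set 'I_n})
    (z : 'I_n) :
  acyclic g -> z \in S ->
  exists2 x, x \in S & forall y, y \in S -> (y, x) \notin g.
Proof.
move=> acg zS; pose r := [rel i j | (i, j) \in g].
pose below x := [set y | connect r y x].
(* An element of [S] reachable from the fewest vertices is minimal: an arc from [y] in [S] to [x]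
   would force [below y] to equal [below x], so [x] would reach [y] and close a cycle. *)
case: (arg_minnP (fun x => #|below x|) zS) => x xS xmin; exists x => // y yS.
apply/negP => gyx; have yx : r y x by [].
have sub : below y \subset below x.
  apply/fintype.subsetP => w; rewrite !inE => /connect_trans; apply.
  exact: connect1.
have : x \in below y.
  suff /eqP -> : below y == below x by rewrite inE.
  by rewrite eqEcard sub xmin.
rewrite inE => /connectP[p xp yp].
by have := acg (x :: p); rewrite /= rcons_path xp -yp => /(_ gyx).
Qed.

Lemma Mcoef_omegaM (R : comNzRingType) (u c : pword) :
  size (val u) = size (val c) ->
  Mcoef u (omegaM R c) =
  (-1) ^+ (size (val c) - wmax (val c)) * (word_le (val u) (val c))%:R.
Proof.
move=> uc; rewrite /omegaM linearZ /= linear_sum /=; congr (_ * _).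
rewrite big_mkcond (bigD1_seq u) ?packed_words_uniq ?mem_packed_words ?uc //=.
rewrite big1 ?addr0 => [|v vu]; first by rewrite Mcoef_M eqxx; case: ifP.
by case: ifP => // _; rewrite Mcoef_M eq_sym (negPf vu).
Qed.

Section Arcs.

Variables (n : nat) (e : rel 'I_n).
Hypothesis e_simple : simple_graph e.

(** For a proper coloring, the orientation of each edge towards its larger letter. *)
Definition ascents (c : seq nat) : {set 'I_n * 'I_n} :=
  [set p | e p.1 p.2 & (nth 0%N c p.1 < nth 0%N c p.2)%N].

Lemma asc_ascents (c : seq nat) : asc_orientation (ascents c) = asc_coloring e c.
Proof.
by apply: eq_card => p; rewrite !inE -andbA andbC -andbA; do !bool_congr.
Qed.

Lemma ascents_acyclic (c : seq nat) : acyclic (ascents c).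
Proof.
case=> // x p; rewrite /= => cyc; exfalso.
have {cyc} : path (fun i j : 'I_n => (nth 0%N c i < nth 0%N c j)%N) x (rcons p x).
  by apply: sub_path cyc => i j /=; rewrite inE => /andP[].
move/order_path_min => /(_ (fun j i k => @ltn_trans _ _ _)).
by rewrite all_rcons ltnn.
Qed.

Lemma ascents_orientation (c : seq nat) :
  proper_coloring e c -> orientation e (ascents c).
Proof.
move=> /forallP pc; have [e_sym _] := e_simple.
apply/andP; split; first by apply/forall_inP => p; rewrite inE => /andP[].
apply/forallP => i; apply/forallP => j; apply/implyP => eij.
rewrite !inE /= -[e j i]e_sym eij /=.
by have := implyP (forallP (pc i) j) eij; case: ltngtP.
Qed.

(** Each edge carries an arc of [g], so increasing along [g] separates adjacent letters; an ascent
    outside [g] would contradict the opposite arc, which is in [g]. *)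
Lemma ascents_eq (g : {set 'I_n * 'I_n}) (c : seq nat) :
  orientation e g ->
  proper_coloring e c && (ascents c == g) =
  [forall p in g, (nth 0%N c p.1 < nth 0%N c p.2)%N].
Proof.
move=> /andP[/forall_inP ge /forallP go]; have [e_sym _] := e_simple.
have orient i j : e i j -> ((i, j) \in g) (+) ((j, i) \in g).
  by move: i j => i j; apply/implyP/(forallP (go i)).
apply/andP/forall_inP => [[_ /eqP <-] p|inc].
  by rewrite inE => /andP[].
split.
  apply/forallP => i; apply/forallP => j; apply/implyP => /orient.
  case: (boolP ((i, j) \in g)) => [/inc /= lt _|_ /= /inc /= lt].
    by rewrite neq_ltn lt.
  by rewrite neq_ltn lt orbT.
apply/eqP/setP => -[i j]; rewrite inE /=; apply/andP/idP => [[eij lt]|gij].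
  have := orient i j eij; case: ((i, j) \in g) => //= /inc /=.
  by move: lt; lia.
by have := ge _ gij; have := inc _ gij.
Qed.

End Arcs.

(** * The coefficient, grouped by orientations *)

Theorem proposition3p1 (K : comNzRingType) (n : nat) (e : rel 'I_n)
    (e_dyck : dyck_graph e) (u : pword) (u_size : size (val u) = n) :
  Mcoef u (omega (chromatic K e)) =
  \sum_(g : {set 'I_n * 'I_n} |
          [&& orientation e g, `[< acyclic g >] & no_descent g (val u)])
    'X^(asc_orientation g).
Proof.
have [e_simple _] := e_dyck.
pose sgn (c : pword) : {poly K} := (-1) ^+ (n - wmax (val c)).
have -> : Mcoef u (omega (chromatic K e)) =
    \sum_(c <- packed_words n |
        proper_coloring e (val c) && refines n (val c) (val u))
      'X^(asc_coloring e (val c)) * sgn c.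
  rewrite /chromatic (linear_sum (@omega _)) linear_sum /=.
  rewrite big_seq_cond [RHS]big_seq_cond.
  rewrite [RHS]big_mkcond [LHS]big_mkcond /=; apply: eq_bigr => c _.
  rewrite mem_packed_words; case: eqP => //= cn; case: ifP => //= _.
  rewrite !linearZ /= omega_M Mcoef_omegaM ?cn ?u_size //.
  rewrite (@word_le_refines n) ?(valP c) ?(valP u) //.
  by case: ifP; rewrite ?mulr1 ?mulr0.
rewrite (partition_big (fun c => ascents e (val c))
  (fun g => [&& orientation e g, `[< acyclic g >] & no_descent g (val u)])) /=.
  apply: eq_bigr => g /and3P[og /asboolP acg /forall_inP ndg].
  pose D := [rel i j : 'I_n | ((i, j) \in g) ||
    (nth 0%N (val u) i < nth 0%N (val u) j)%N].
  have D_wf (S : {set 'I_n}) z : z \in S ->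
      exists2 x, x \in S & forall y, y \in S -> ~~ D y x.
    (* Take the lowest level of [u] in [S], then a [g]-minimal element of that level. An arc into it
       from a higher level would be a [u]-descent. *)
    move=> zS; pose lev (x : 'I_n) := nth 0%N (val u) x.
    case: (arg_minnP lev zS) => m mS m_min.
    have mS' : m \in [set x in S | lev x == lev m].
      by rewrite inE eqxx andbT; exact: mS.
    have [x] := acyclic_min acg mS'; rewrite inE => /andP[xS /eqP xm] xmin.
    exists x => // y yS; rewrite negb_or -leqNgt -/(lev x) -/(lev y) xm m_min //.
    rewrite andbT; apply/negP => gyx.
    have := ndg _ gyx; rewrite /= -/(lev x) -/(lev y) -leqNgt xm => ym.
    by move: gyx; apply/negP/xmin; rewrite inE yS eqn_leq ym m_min.
  transitivity ('X^(asc_orientation g) * \sum_(c <- packed_words n |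
      strict D (val c)) sgn c); last first.
    rewrite (_ : \sum_(c <- _ | _) _ = 1) ?mulr1 //.
    (* The integer identity is carried to [{poly K}], where a sum equal to its opposite need not
       vanish. *)
    have /(congr1 (fun z : int => z%:~R : {poly K})) := sum_strict D_wf.
    rewrite rmorph_sum; apply: eq_trans.
    by apply: eq_bigr => c _; rewrite rmorphXn /= rmorphN1.
  rewrite mulr_sumr; apply: eq_big => [c|c /andP[_ /eqP <-]]; last first.
    by rewrite asc_ascents.
  rewrite andbAC (ascents_eq e_simple _ og).
  apply/andP/strictP => [[/forall_inP inc /refinesP ref] i j /orP[/inc|/ref] //|H].
  split; first by apply/forall_inP => -[i j] gij; apply: H; rewrite /= gij.
  by apply/refinesP => i j lt; apply: H; rewrite /= lt orbT.
move=> c /andP[pc /refinesP ref].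
apply/and3P; split; first exact: ascents_orientation.
  exact/asboolP/ascents_acyclic.
(* As [c] refines [u], a [u]-descent along an arc would be a descent of [c], while [c] increases
   along its arcs. *)
apply/forall_inP => -[i j]; rewrite inE /= => /andP[_ lt].
by apply/negP => /ref; rewrite ltnNge (ltnW lt).
Qed.
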